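(* Let $H$ be a real Hilbert space, $A:H\to c_0$ bounded linear with adjoint $A^*:\ell^1\to H$ (identifying $c_0^*=\ell^1$), with $A$ and $A^*$ injective. Let $(H_n)_{n\in\mathbb N}$ be subspaces of $H$ with $\dim H_n=n$ whose orthogonal projections $P_n$ satisfy $P_nv\to v$ for all $v\in H$. Let $f\in H$, $u^\dagger\in\ell^1$ with $A^*u^\dagger=f$, and suppose there is $v^\dagger\in H$ with $\|Av^\dagger\|_\infty\le1$, $(Av^\dagger)_i=\operatorname{sign}(u^\dagger_i)$ whenever $u^\dagger_i\ne0$, and $|(Av^\dagger)_i|=1$ if and only if $i\in\operatorname{supp}u^\dagger$. Then there exist $C>0$ and $n_0\in\mathbb N$ such that for all $n\ge n_0$, all $\delta>0$, all $f^\delta\in H$ with $\|f^\delta-f\|\le\delta$, and any solution $u^n$ of $\min\{\|u\|_1:u\in\ell^1,\ P_nA^*u=P_nf^\delta\}$, $$\|u^n-u^\dagger\|_1\le C\,\delta\,\kappa_n.$$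
   Context: $A^*$ is defined by $\langle A^*u,z\rangle=\sum_iu_i(Az)_i$. $\operatorname{supp}u=\{i:u_i\ne0\}$. $\kappa_n=\sup_{z\in H_n\setminus\{0\}}\|z\|/\|Az\|_\infty$. *)

(* Defs.v *)
From HB Require Import structures.
From mathcomp Require Import all_boot all_order all_algebra.
From mathcomp Require Import all_classical all_reals all_analysis.
Set Implicit Arguments. Unset Strict Implicit. Unset Printing Implicit Defensive.
Import Order.TTheory GRing.Theory Num.Theory.
Import numFieldNormedType.Exports.
Local Open Scope classical_set_scope.
Local Open Scope ring_scope.

Section Defs.
Variable R : realType.

Definition is_inner_product (H : normedModType R) (ip : H -> H -> R) : Prop :=
  [/\ (forall x y, ip x y = ip y x),
      (forall (a : R) x y z, ip (a *: x + y) z = a * ip x z + ip y z)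
    & (forall x, ip x x = `|x| ^+ 2)].

Definition rsum (u : nat -> R) : R := limn (series u).

Definition in_l1 (u : nat -> R) : Prop := cvgn (series (fun i => `|u i|)).

Definition l1norm (u : nat -> R) : R := rsum (fun i => `|u i|).

(* sup norm (used on elements of c0, where it is finite) *)
Definition supnorm (x : nat -> R) : R := sup (range (fun i => `|x i|)).

Definition in_c0 (x : nat -> R) : Prop := (x i)%R @[i --> \oo] --> (0 : R).

Definition subspace_dim (H : normedModType R) (S : set H) (n : nat) : Prop :=
  exists b : 'I_n -> H,
    (forall c : 'I_n -> R, \sum_(i < n) c i *: b i = 0 -> forall i, c i = 0) /\
    S = [set x | exists c : 'I_n -> R, x = \sum_(i < n) c i *: b i].

Definition is_orth_proj (H : normedModType R) (ip : H -> H -> R)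
    (S : set H) (P : H -> H) : Prop :=
  forall v, S (P v) /\ (forall w, S w -> ip (v - P v) w = 0).

Definition kappa (H : normedModType R) (A : H -> nat -> R) (S : set H) : \bar R :=
  ereal_sup [set ((`|z| / supnorm (A z))%:E) | z in S `\ 0].
End Defs.

(* Main.v *)
(** Let [K = delta * kappa_n].  The functional [A z |-> <fd - f, z>] on [A H_n]
    has norm at most [K], so by Hahn-Banach it is induced by some [c] in l1 with
    [|c|_1 <= K].  Hence [udag + c] is feasible and [|un|_1 <= |udag|_1 + K].
    Since [A vdag] tends to 0, [udag] is supported in some [[0, N)] and
    [|A vdag| <= 1/2] beyond [N]; so, with [h = un - udag], half of the l1 mass of
    [h] beyond [N] is at most [K - <h, A vdag>].  Injectivity of [A^*] yields
    [w_0, ..., w_(N-1)] dual to the first [N] coordinates of [A], and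
    [<h, A w_j>] controls [h_j].  The pairings [<h, A v>], with [v = vdag] or
    [w_j], are at most [delta |P_n v| + |A (v - P_n v)|_oo |h|_1], and for large
    [n] the last term is absorbed in the left hand side. *)

Require Import Defs.
From HB Require Import structures.
From mathcomp Require Import all_boot all_order all_algebra.
From mathcomp Require Import all_classical all_reals all_analysis.
From mathcomp Require Import ring lra.
Set Implicit Arguments.
Unset Strict Implicit.
Unset Printing Implicit Defensive.

Import Order.TTheory GRing.Theory Num.Theory.
Import numFieldNormedType.Exports.
Local Open Scope classical_set_scope.
Local Open Scope ring_scope.

(** * Summable sequences, null sequences and their norms *)

Section SummableSequences.
Variable R : realType.
Implicit Types (u x : nat -> R) (B : R).

Lemma in_l1_cvg u : in_l1 u -> cvgn (series u).
Proof. exact: normed_cvg. Qed.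

Lemma in_l1_le u v : in_l1 v -> (forall i, `|u i| <= `|v i|) -> in_l1 u.
Proof. by move=> v1 uv; apply: series_le_cvg v1. Qed.

Lemma in_l1D u v : in_l1 u -> in_l1 v -> in_l1 (u + v).
Proof.
move=> u1 v1; apply: (@series_le_cvg _ _ _ _ _ _ (is_cvg_seriesD u1 v1)) => i /=;
  rewrite ?fctE ?addr_ge0 //.
exact: ler_normD.
Qed.

Lemma in_l1N u : in_l1 u -> in_l1 (- u).
Proof. by move=> u1; apply: (in_l1_le u1) => i; rewrite normrN. Qed.

Lemma in_l1M u x B : in_l1 u -> (forall i, `|x i| <= B) ->
  in_l1 (fun i => u i * x i).
Proof.
move=> u1 xB; have B0 : 0 <= B by rewrite (le_trans _ (xB 0%N)).
have vc : cvgn (series (fun i => B * `|u i|))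
  by exact: (@is_cvg_seriesZ R (fun i => `|u i|) B u1).
apply: (@series_le_cvg _ _ _ _ _ _ vc) => i //; rewrite ?mulr_ge0 //.
by rewrite normrM mulrC ler_wpM2r.
Qed.

Lemma rsumD u v : in_l1 u -> in_l1 v -> rsum (u + v) = rsum u + rsum v.
Proof. by move=> u1 v1; apply: lim_seriesD; exact: in_l1_cvg. Qed.

Lemma rsumN u : in_l1 u -> rsum (- u) = - rsum u.
Proof. by move=> u1; apply: lim_seriesN; exact: in_l1_cvg. Qed.

Lemma rsumZ a u : in_l1 u -> rsum (fun i => a * u i) = a * rsum u.
Proof. by move=> u1; apply: (@lim_seriesZ R u a); exact: in_l1_cvg. Qed.

Lemma rsum_le u v : in_l1 u -> in_l1 v -> (forall i, u i <= v i) ->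
  rsum u <= rsum v.
Proof. by move=> u1 v1; apply: lim_series_le; exact: in_l1_cvg. Qed.

Lemma in_l1_norm u : in_l1 u -> in_l1 (fun i => `|u i|).
Proof. by move=> u1; apply: (in_l1_le u1) => i; rewrite normr_id. Qed.

Lemma l1normD u v : in_l1 u -> in_l1 v -> l1norm (u + v) <= l1norm u + l1norm v.
Proof.
move=> u1 v1; rewrite /l1norm -rsumD; try exact: in_l1_norm.
apply: rsum_le => [||i]; [exact/in_l1_norm/in_l1D| |exact: ler_normD].
by apply: in_l1D; exact: in_l1_norm.
Qed.

Lemma norm_rsum_mul u x B : in_l1 u -> (forall i, `|x i| <= B) ->
  `|rsum (fun i => u i * x i)| <= B * l1norm u.
Proof.
move=> u1 xB; have ux1 := in_l1M u1 xB.
have vE : rsum (fun i => B * `|u i|) = B * l1norm u.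
  by rewrite rsumZ //; exact: in_l1_norm.
rewrite -vE; apply: le_trans (@lim_series_norm R R _ ux1) _.
apply: lim_series_le => // [|i].
  exact: (@is_cvg_seriesZ R (fun i => `|u i|) B u1).
by rewrite /= normrM mulrC ler_wpM2r.
Qed.

Lemma finite_support_series N u : (forall i, (N <= i)%N -> u i = 0) ->
  series u @ \oo --> \sum_(i < N) u i.
Proof.
move=> u0; apply: (@cvg_near_cst _ R); near=> m.
have Nm : (N <= m)%N by near: m; exists N.
rewrite seriesEnat /= (big_cat_nat _ Nm) //= big_mkord.
suff -> : \sum_(N <= i < m) u i = 0 by rewrite addr0.
by rewrite big_nat big1 // => i /andP[/u0].
Unshelve. all: by end_near. Qed.

Lemma finite_support_l1 N u : (forall i, (N <= i)%N -> u i = 0) -> in_l1 u.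
Proof.
move=> u0; apply: cvgP; apply: (@finite_support_series N) => i Ni.
by rewrite u0 // normr0.
Qed.

Lemma finite_support_rsum N u : (forall i, (N <= i)%N -> u i = 0) ->
  rsum u = \sum_(i < N) u i.
Proof. by move=> u0; apply: cvg_lim => //; exact: finite_support_series. Qed.

Definition tail N u : nat -> R := fun i => if (i < N)%N then 0 else u i.

Lemma in_l1_tail N u : in_l1 u -> in_l1 (tail N u).
Proof.
move=> u1; apply: (in_l1_le u1) => i; rewrite /tail.
by case: ifP; rewrite ?normr0.
Qed.

Lemma rsum_split N u : in_l1 u ->
  rsum u = \sum_(i < N) u i + rsum (tail N u).
Proof.
move=> u1; pose v i := if (i < N)%N then u i else 0.
have v0 i : (N <= i)%N -> v i = 0 by rewrite /v ltnNge => ->.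
have -> : u = v + tail N u.
  by apply/funext => i; rewrite fctE /v /tail; case: ifP; rewrite ?addr0 ?add0r.
rewrite rsumD; [|exact: finite_support_l1 v0|exact: in_l1_tail].
rewrite (@finite_support_rsum N) //; congr (_ + rsum _).
  apply: eq_bigr => i _; rewrite !fctE /v /tail ltn_ord addr0 //.
by apply/funext => i; rewrite /tail !fctE /v /tail; case: (i < N)%N; rewrite ?add0r.
Qed.

Lemma l1norm_split N u : in_l1 u ->
  l1norm u = \sum_(i < N) `|u i| + l1norm (tail N u).
Proof.
move=> u1; rewrite /l1norm (@rsum_split N); last exact: in_l1_norm.
congr (_ + rsum _); apply/funext => i; rewrite /tail.
by case: ifP; rewrite ?normr0.
Qed.

Lemma bounded_partial_sums_l1 u B : (forall n, \sum_(i < n) `|u i| <= B) ->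
  in_l1 u /\ l1norm u <= B.
Proof.
move=> uB.
have u1 : in_l1 u.
  apply: nondecreasing_is_cvgn; first exact: nondecreasing_series.
  by exists B => _ [n _ <-]; rewrite seriesEord; exact: uB.
split => //; apply: limr_le => //; apply: nearW => n /=; rewrite seriesEord; exact: uB.
Qed.

Lemma in_c0_bounded x : in_c0 x -> exists B, forall i, `|x i| <= B.
Proof.
move=> x0; have /cvg_seq_bounded[M [_ HM]] : cvgn x by apply: cvgP x0.
exists (M + 1) => i; apply: HM => //; rewrite ltrDl; exact: ltr01.
Qed.

Lemma norm_le_supnorm x i : in_c0 x -> `|x i| <= supnorm x.
Proof.
move=> /in_c0_bounded[B xB]; apply: ub_le_sup; last by exists i.
by exists B => _ [j _ <-].
Qed.

Lemma supnorm_le x B : (forall i, `|x i| <= B) -> supnorm x <= B.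
Proof.
by move=> xB; apply: ge_sup; [exists `|x 0%N|; exists 0%N|move=> _ [i _ <-]].
Qed.

Lemma in_c0_near x e : in_c0 x -> 0 < e ->
  exists N, forall i, (N <= i)%N -> `|x i| <= e.
Proof.
move=> x0 e0; have /cvgr0Pnorm_le/(_ e e0) := x0.
by case=> N _ HN; exists N => i Ni; exact: HN.
Qed.

End SummableSequences.

(** * Hahn-Banach extension, one coordinate at a time *)

(** The one-dimensional Hahn-Banach choice. A point with [t' < 0] and one with [t > 0] combine, with
    weights [t] and [- t'], to a point over 0, where [s] is nonnegative. Hence every quotient
    [s' / t'] on the left is at most every [s / t] on the right, and the supremum of the left ones
    serves as [a]. *)
Lemma slope_below_cone (R : realType) (D : R -> R -> Prop) :
  (forall t1 s1 t2 s2 c1 c2, 0 < c1 -> 0 < c2 -> D t1 s1 -> D t2 s2 ->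
     D (c1 * t1 + c2 * t2) (c1 * s1 + c2 * s2)) ->
  (forall s, D 0 s -> 0 <= s) -> (exists s, D 1 s) -> (exists s, D (-1) s) ->
  exists a, forall t s, D t s -> a * t <= s.
Proof.
move=> DD D0 [s1 D1] [s2 DN1].
pose E : set R := [set r | exists t s, [/\ D t s, t < 0 & r = s / t]].
have ubE t s : D t s -> 0 < t -> ubound E (s / t).
  move=> Dts t0 _ [t' [s' [Dts' t'0 ->]]].
  have nt'0 : 0 < - t' by rewrite oppr_gt0.
  have := DD _ _ _ _ _ _ nt'0 t0 Dts Dts'.
  have -> : - t' * t + t * t' = 0 by ring.
  move=> /D0 H; rewrite ler_ndivrMr // mulrAC ler_pdivrMr //.
  by rewrite -subr_ge0; move: H; congr (_ <= _); ring.
have hE : has_ubound E by exists (s1 / 1); apply: ubE.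
have E0 : E !=set0 by exists (s2 / -1), (-1), s2; rewrite oppr_lt0.
exists (sup E) => t s Dts.
have [t0|t0|t0] := ltrgt0P t.
- by rewrite -ler_pdivlMr //; apply: ge_sup => //; exact: ubE.
- by rewrite -ler_ndivrMr //; apply: ub_le_sup => //; exists t, s.
- by rewrite t0 mulr0; apply: D0; rewrite -t0.
Qed.

Lemma linear_seq_zero (R : realType) (V : lmodType R) (A : V -> nat -> R) :
  (forall (a : R) x y, A (a *: x + y) = (fun i => a * A x i + A y i)) ->
  forall i, A 0 i = 0.
Proof.
move=> linA i.
have := linA 1 0 0; rewrite scaler0 addr0 => /(congr1 (fun h => h i)).
by move=> /eqP; rewrite mul1r -subr_eq0 opprD addrA subrr sub0r oppr_eq0 => /eqP.
Qed.

Section BoundedFunctionalExtension.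
Variables (R : realType) (V : lmodType R) (S : set V).
Variables (A : V -> nat -> R) (L : V -> R) (K : R).
Hypothesis S0 : S 0.
Hypothesis SD : forall a x y, S x -> S y -> S (a *: x + y).
Hypothesis linA : forall (a : R) x y, A (a *: x + y) = (fun i => a * A x i + A y i).
Hypothesis linL : forall (a : R) x y, L (a *: x + y) = a * L x + L y.
Hypothesis A_c0 : forall z, in_c0 (A z).
Hypothesis LK : forall z (b : R), S z -> (forall i, `|A z i| <= b) -> L z <= K * b.
Hypothesis K0 : 0 <= K.

Let A0 i : A 0 i = 0.
Proof. exact: linear_seq_zero. Qed.

Let L0 : L 0 = 0.
Proof.
have := linL 1 0 0; rewrite scaler0 addr0 mul1r => /eqP.
by rewrite -subr_eq0 opprD addrA subrr sub0r oppr_eq0 => /eqP.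
Qed.

Let linA2 a b x y i : A (a *: x + b *: y) i = a * A x i + b * A y i.
Proof. by rewrite linA -[b *: y]addr0 linA A0 addr0. Qed.

Let linL2 a b x y : L (a *: x + b *: y) = a * L x + b * L y.
Proof. by rewrite linL -[b *: y]addr0 linL L0 addr0. Qed.

(* The functional A z + c |-> L z + <w, c>, for z in S and c supported in
   [0, k), is bounded by K times the sup norm; x stands for A z + c. *)
Definition extension_bounded k (w : nat -> R) := forall z (x : nat -> R) (b : R), S z ->
  (forall i, (k <= i)%N -> x i = A z i) -> (forall i, `|x i| <= b) ->
  L z + \sum_(i < k) w i * (x i - A z i) <= K * b.

(** With [t] the new coordinate of [c] and [s] the slack left in the old bound, a value [a] is
    admissible when [a * t <= s] throughout. These pairs form a convex cone, and over [t = 0] the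
    slack is nonnegative by the bound at stage [k]. *)
Lemma extension_bounded_step k w : extension_bounded k w ->
  exists a, extension_bounded k.+1 (fun i => if i == k then a else w i).
Proof.
move=> kw.
pose l z (x : nat -> R) := L z + \sum_(i < k) w i * (x i - A z i).
pose D t s := exists z (x : nat -> R) (b : R),
  [/\ S z, (forall i, (k < i)%N -> x i = A z i),
  (forall i, `|x i| <= b), t = x k - A z k & s = K * b - l z x].
(* Multiples of the [k]-th unit vector, with [z = 0], give points of the cone over 1 and -1. *)
have De e : `|e| <= 1 -> D e (K - l 0 (fun i => if i == k then e else 0)).
  move=> e1; exists 0, (fun i => if i == k then e else 0), 1; split => //.
  - by move=> i ki; rewrite gtn_eqF // A0.
  - by move=> i; case: ifP => // _; rewrite normr0.
  - by rewrite eqxx A0 subr0.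
  - by rewrite mulr1.
have [a Ha] : exists a, forall t s, D t s -> a * t <= s.
  apply: slope_below_cone.
  - move=> t1 s1 t2 s2 c1 c2 c10 c20 [z1 [x1 [b1 [Sz1 xz1 xb1 -> ->]]]].
    move=> [z2 [x2 [b2 [Sz2 xz2 xb2 -> ->]]]].
    exists (c1 *: z1 + c2 *: z2), (fun i => c1 * x1 i + c2 * x2 i), (c1 * b1 + c2 * b2).
    split => //.
    + by apply: SD => //; rewrite -[_ *: _]addr0; apply: SD.
    + by move=> i ki; rewrite linA2 xz1 // xz2.
    + move=> i; rewrite (le_trans (ler_normD _ _)) // !normrM.
      rewrite (gtr0_norm c10) (gtr0_norm c20).
      by apply: lerD; rewrite ler_pM2l.
    + by rewrite linA2; ring.
    + have -> : l (c1 *: z1 + c2 *: z2) (fun i => c1 * x1 i + c2 * x2 i)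
          = c1 * l z1 x1 + c2 * l z2 x2.
        rewrite /l linL2 !mulrDr !mulr_sumr addrACA -big_split /=.
        by congr (_ + _); apply: eq_bigr => i _; rewrite linA2; ring.
      by ring.
  - move=> s [z [x [b [Sz xz xb /eqP]]]]; rewrite eq_sym subr_eq0 => /eqP xk ->.
    rewrite subr_ge0; apply: kw => // i; rewrite leq_eqVlt => /orP[/eqP <- //|].
    exact: xz.
  - by eexists; apply: De; rewrite normr1.
  - by eexists; apply: De; rewrite normrN normr1.
exists a => z x b Sz xz xb; rewrite big_ord_recr /= eqxx.
have := Ha (x k - A z k) (K * b - l z x); rewrite lerBrDr => H.
have : D (x k - A z k) (K * b - l z x) by exists z, x, b.
move=> /H; apply: le_trans; rewrite addrA addrC lerD2l lerD2l ler_sum // => i _.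
by rewrite ltn_eqF.
Qed.

(** A step changes only the entry [k], so entries once chosen persist, and the diagonal of the
    stages [W] agrees with [W k] below [k]. *)
Lemma extension_bounded_sequence : exists w, forall k, extension_bounded k w.
Proof.
pose F k w a := (fun i : nat => if i == k then a else w i) : nat -> R.
pose W := fix W k := if k is m.+1 then
  F m (W m) (xget 0 [set a | extension_bounded m.+1 (F m (W m) a)]) else fun=> 0.
have WP k : extension_bounded k (W k).
  elim: k => [|k /extension_bounded_step IH] /=.
    move=> z x b Sz xz xb; rewrite big_ord0 addr0; apply: LK => // i.
    by rewrite -xz.
  exact: (xgetPex 0 IH).
have WE k i : (i < k)%N -> W k i = W i.+1 i.
  elim: k => // k IH; rewrite ltnS leq_eqVlt => /orP[/eqP <- //|ik].
  by rewrite /= {1}/F ltn_eqF // IH.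
exists (fun i => W i.+1 i) => k z x b Sz xz xb.
have := WP k z x b Sz xz xb; congr (_ + _ <= _); apply: eq_bigr => i _.
by rewrite WE.
Qed.

(** The stagewise bounds are tested twice: on sign patterns for the norm of [w], and on [A z] with
    its first entries erased for the values. The latter gives one inequality, and replacing [z] by
    [- z] gives the other. *)
Lemma bounded_functional_extension : exists w, [/\ in_l1 w, l1norm w <= K &
  forall z, S z -> rsum (fun i => w i * A z i) = L z].
Proof.
have [w wP] := extension_bounded_sequence.
have [w1 wK] : in_l1 w /\ l1norm w <= K.
  apply: bounded_partial_sums_l1 => n.
  have := wP n 0 (fun i => if (i < n)%N then Num.sg (w i) else 0) 1 S0.
  rewrite L0 add0r mulr1 => H; apply: le_trans (H _ _).
  - apply: ler_sum => i _; rewrite ltn_ord A0 subr0 normrEsg mulrC //.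
  - by move=> i ni; rewrite ltnNge ni /= A0.
  - move=> i; case: ifP => _; rewrite ?normr0 // normr_sg.
    by case: (_ != 0); rewrite ?lexx ?ler01.
exists w; split => // z Sz.
have wA1 y : in_l1 (fun i => w i * A y i).
  by have [B] := in_c0_bounded (A_c0 y); exact: in_l1M.
have ge y : S y -> L y <= rsum (fun i => w i * A y i).
  move=> Sy; apply/ler_addgt0Pr => e e0.
  have [B [B0 KB]] : exists B, 0 < B /\ K * B <= e.
    (* The denominator [K + 1] also covers [K = 0]. *)
    exists (e / (K + 1)); split; first by rewrite divr_gt0 // ltr_wpDl.
    rewrite mulrCA ger_pMr // ler_pdivrMr ?ltr_wpDl // mul1r lerDl //.
  rewrite -lerBlDr.
  have [N HN] := in_c0_near (A_c0 y) B0.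
  have cv := in_l1_cvg (wA1 y).
  apply: limr_ge => //; near=> n.
  have Nn : (N <= n)%N by near: n; exists N.
  (* Erasing the first [n] entries leaves a sequence bounded by [B], because [A y] tends to 0; the
     erased part is [c = - A y] on [[0, n)]. *)
  have := wP n y (fun i => if (i < n)%N then 0 else A y i) B Sy.
  move=> /(_ _ _)/le_trans/(_ KB).
  rewrite seriesEord /= lerBlDr.
  have -> : \sum_(i < n) w i * ((if (i < n)%N then 0 else A y i) - A y i)
     = - \sum_(i < n) w i * A y i.
    by rewrite -sumrN; apply: eq_bigr => i _; rewrite ltn_ord sub0r mulrN.
  rewrite lerBlDr addrC; apply.
  - by move=> i; rewrite leqNgt => /negbTE ->.
  - move=> i; case: ltnP => [_|ni]; first by rewrite normr0 ltW.
    by apply: HN; apply: leq_trans ni.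
apply/le_anti/andP; split; last exact: ge.
have SNz : S (- z) by rewrite -scaleN1r -[_ *: _]addr0; apply: SD.
have := ge _ SNz; rewrite -scaleN1r -[_ *: _]addr0 linL L0 mulN1r addr0 addr0.
have -> : (fun i => w i * A (-1 *: z) i) = - (fun i => w i * A z i).
  by apply/funext => i; rewrite -[_ *: _]addr0 linA A0 fctE; ring.
by rewrite rsumN // lerN2.
Unshelve. all: by end_near. Qed.

End BoundedFunctionalExtension.

(** * Inner products, orthogonal projections and finite-dimensional subspaces *)

Section InnerProduct.
Variables (R : realType) (H : normedModType R) (ip : H -> H -> R).
Hypothesis ipP : is_inner_product ip.

Lemma ipC x y : ip x y = ip y x.
Proof. by case: ipP. Qed.

Lemma ipDZl a x y z : ip (a *: x + y) z = a * ip x z + ip y z.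
Proof. by case: ipP. Qed.

Lemma ip_norm x : ip x x = `|x| ^+ 2.
Proof. by case: ipP. Qed.

Lemma ip0l z : ip 0 z = 0.
Proof.
have := ipDZl 1 0 0 z; rewrite scaler0 addr0 mul1r => /eqP.
by rewrite -subr_eq0 opprD addrA subrr sub0r oppr_eq0 => /eqP.
Qed.

Lemma ipDl x y z : ip (x + y) z = ip x z + ip y z.
Proof. by rewrite -[x]scale1r ipDZl mul1r scale1r. Qed.

Lemma ipZl a x z : ip (a *: x) z = a * ip x z.
Proof. by rewrite -[_ *: _]addr0 ipDZl ip0l addr0. Qed.

Lemma ipBl x y z : ip (x - y) z = ip x z - ip y z.
Proof. by rewrite -scaleN1r ipDl ipZl mulN1r. Qed.

Lemma ip_self_eq0 x : ip x x = 0 -> x = 0.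
Proof. by rewrite ip_norm => /eqP; rewrite sqrf_eq0 normr_eq0 => /eqP. Qed.

Lemma ip_le x y : ip x y <= `|x| * `|y|.
Proof.
have [->|x0] := eqVneq x 0; first by rewrite ip0l mulr_ge0.
have [->|y0] := eqVneq y 0; first by rewrite ipC ip0l mulr_ge0.
(* This square expands to [2 * (|x| * |y|) * (|x| * |y| - ip x y)]. *)
have : 0 <= ip (`|y| *: x + (- `|x|) *: y) (`|y| *: x + (- `|x|) *: y).
  by rewrite ip_norm sqr_ge0.
rewrite !(ipDl, ipZl) !(ipC _ (_ + _)) !(ipDl, ipZl) !ip_norm (ipC y x).
set c := ip x y => ge0.
have xy0 : 0 < `|x| * `|y| by rewrite mulr_gt0 // normr_gt0.
have : 0 <= 2 * (`|x| * `|y|) * (`|x| * `|y| - c).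
  by move: ge0; congr (_ <= _); ring.
by rewrite pmulr_rge0 ?subr_ge0 // mulr_gt0.
Qed.

Lemma normr_ip_le x y : `|ip x y| <= `|x| * `|y|.
Proof.
rewrite ler_norml ip_le andbT lerNl -mulN1r -ipZl scaleN1r.
by rewrite (le_trans (ip_le _ _)) // normrN.
Qed.

(** Turns the constraint of the minimisation problem into testing against [S]. For the converse,
    [P x - P y] lies in [S] and is orthogonal to itself. *)
Lemma orth_proj_eqP (S : set H) (P : H -> H) x y :
  (forall a u v, S u -> S v -> S (a *: u + v)) -> is_orth_proj ip S P ->
  P x = P y <-> (forall z, S z -> ip (x - y) z = 0).
Proof.
move=> SD PP; split=> [Pxy z Sz|xy0].
  have [_ /(_ z Sz)] := PP x; have [_ /(_ z Sz)] := PP y; rewrite !ipBl Pxy; lra.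
have [SPx xP] := PP x; have [SPy yP] := PP y.
have Sd : S (P x - P y) by rewrite addrC -scaleN1r; exact: SD.
apply/eqP; rewrite -subr_eq0; apply/eqP; apply: ip_self_eq0.
by have := xP _ Sd; have := yP _ Sd; have := xy0 _ Sd; rewrite !ipBl; lra.
Qed.

End InnerProduct.

Lemma subspace_dim_lin (R : realType) (H : normedModType R) (S : set H) n :
  subspace_dim S n -> forall (a : R) u v, S u -> S v -> S (a *: u + v).
Proof.
move=> [b [_ ->]] a _ _ [c ->] [d ->]; exists (fun i => a * c i + d i).
by rewrite scaler_sumr -big_split; apply: eq_bigr => i _; rewrite scalerDl scalerA.
Qed.

Lemma subspace_dim_zero (R : realType) (H : normedModType R) (S : set H) n :
  subspace_dim S n -> S 0.
Proof.
move=> [b [_ ->]]; exists (fun=> 0).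
by rewrite big1 // => i _; rewrite scale0r.
Qed.

Lemma subspace_dim_nonzero (R : realType) (H : normedModType R) (S : set H) n :
  subspace_dim S n.+1 -> (S `\ 0) !=set0.
Proof.
move=> [b [free ->]]; pose c (i : 'I_n.+1) : R := (i == ord0)%:R.
exists (\sum_(i < n.+1) c i *: b i); split; first by exists c.
by move=> /free/(_ ord0)/eqP; rewrite /c eqxx oner_eq0.
Qed.

(** * Dual systems from injectivity of the adjoint *)

Section AdjointPair.
Variables (R : realType) (H : normedModType R) (ip : H -> H -> R).
Variables (A : H -> nat -> R) (Astar : (nat -> R) -> H).
Hypothesis ipP : is_inner_product ip.
Hypothesis linA : forall (a : R) x y, A (a *: x + y) = (fun i => a * A x i + A y i).
Hypothesis adj : forall u, in_l1 u ->
  forall z, ip (Astar u) z = rsum (fun i => u i * A z i).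
Hypothesis Astar_inj : forall u w, in_l1 u -> in_l1 w -> Astar u = Astar w -> u = w.

Lemma linear_seq_sum n (c : 'I_n -> R) (w : 'I_n -> H) i :
  A (\sum_(j < n) c j *: w j) i = \sum_(j < n) c j * A (w j) i.
Proof.
elim: n c w => [|n IH] c w; first by rewrite !big_ord0 (linear_seq_zero linA).
by rewrite !big_ord_recl linA IH.
Qed.

Lemma adjoint_annihilator_eq0 c : in_l1 c ->
  (forall z, rsum (fun i => c i * A z i) = 0) -> forall i, c i = 0.
Proof.
move=> c1 c0 i.
have zero1 : in_l1 (fun=> 0 : R) by apply: (@finite_support_l1 _ 0%N).
suff -> : c = (fun=> 0) by [].
(* The same argument serves [c] and the zero sequence: [Astar u] is orthogonal to everything, hence
   to itself. *)
apply: Astar_inj => //; have eq0 u : in_l1 u ->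
    (forall z, rsum (fun i => u i * A z i) = 0) -> Astar u = 0.
  by move=> u1 u0; apply: (ip_self_eq0 ipP); rewrite adj.
rewrite !eq0 // => z; rewrite (@finite_support_rsum _ 0%N) ?big_ord0 // => j _.
by rewrite mul0r.
Qed.

(** Induction on [N]. Were coordinate [N] to vanish wherever the first [N] do, it would be a linear
    combination of them, and a nonzero finite sequence would annihilate the range of [A]. *)
Lemma dual_system N : exists w : nat -> H,
  forall i j, (i < N)%N -> (j < N)%N -> A (w j) i = (i == j)%:R.
Proof.
elim: N => [|N [w wP]]; first by exists (fun=> 0).
have [z [z0 zN]] : exists z, (forall i, (i < N)%N -> A z i = 0) /\ A z N != 0.
  apply: contrapT => noz.
  have zN z : (forall i, (i < N)%N -> A z i = 0) -> A z N = 0.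
    move=> z0; apply/eqP; apply: contrapT => /negP zN; apply: noz; by exists z.
  (* Subtracting from [z] the combination of the [w j] with the same first [N] coordinates gives
     [z'], and the pairing of [c] with [A z] is exactly [A z' N]. *)
  pose c i : R := if (i < N)%N then - A (w i) N else (i == N)%:R.
  have c_supp i : (N.+1 <= i)%N -> c i = 0.
    by move=> Ni; rewrite /c ltnNge ltnW //= gtn_eqF.
  have /(_ N)/eqP : forall i, c i = 0.
    apply: adjoint_annihilator_eq0; first exact: finite_support_l1 c_supp.
    move=> z; rewrite (@finite_support_rsum _ N.+1); last first.
      by move=> i Ni; rewrite c_supp // mul0r.
    pose z' := (-1) *: (\sum_(j < N) A z j *: w j) + z.
    have z'E i : A z' i = A z i - \sum_(j < N) A z j * A (w j) i.
      by rewrite linA linear_seq_sum mulN1r addrC.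
    have z'N : A z' N = 0.
      apply: zN => i iN; rewrite z'E (bigD1 (Ordinal iN)) //= wP // eqxx mulr1.
      rewrite big1 ?addr0 ?subrr // => j ji; rewrite wP //.
      by move: ji; rewrite [i == j]eq_sym -val_eqE => /negbTE /= ->; rewrite mulr0.
    rewrite -[RHS]z'N z'E big_ord_recr /= /c ltnn eqxx mul1r addrC -sumrN; congr (_ + _).
    by apply: eq_bigr => i _; rewrite ltn_ord mulNr mulrC.
  by rewrite /c ltnn eqxx oner_eq0.
pose v := (A z N)^-1 *: z + 0.
have vE i : A v i = (A z N)^-1 * A z i by rewrite linA (linear_seq_zero linA) addr0.
(* The multiple of [v] cancels coordinate [N] of [w j]; since [v] vanishes in the first [N]
   coordinates, the earlier relations survive. *)
exists (fun j => if j == N then v else (- A (w j) N) *: v + w j) => i j.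
rewrite ltnS leq_eqVlt => /orP[/eqP ->|iN]; rewrite ltnS leq_eqVlt => /orP[/eqP ->|jN].
- by rewrite !eqxx vE mulVf.
- rewrite (ltn_eqF jN) (gtn_eqF jN) linA vE mulVf // mulr1 addNr //.
- by rewrite eqxx (ltn_eqF iN) vE (z0 i) // mulr0.
- by rewrite (ltn_eqF jN) linA vE (z0 i) // !mulr0 add0r wP.
Qed.

End AdjointPair.

(** * Coordinatewise l1 estimates and approximation of finitely many vectors *)

(** The inequality holds entrywise. As [u i * x i] is the modulus of [u i], the first two terms add
    up to [un i * x i]. Beyond [N] the entry [u i] is 0, since [x] has modulus 1 on the support of
    [u], and [un i * x i] uses at most half of the modulus of [un i]. *)
Lemma sign_source_lower_bound (R : realType) (u un x : nat -> R) N :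
  in_l1 u -> in_l1 un -> (forall i, `|x i| <= 1) ->
  (forall i, u i != 0 -> x i = Num.sg (u i)) ->
  (forall i, (N <= i)%N -> `|x i| <= 2^-1) ->
  l1norm u + rsum (fun i => (un - u) i * x i) + 2^-1 * l1norm (tail N (un - u))
    <= l1norm un.
Proof.
move=> u1 un1 x1 xs xN; set h := un - u.
have h1 : in_l1 h by apply: in_l1D => //; exact: in_l1N.
have hx1 : in_l1 (fun i => h i * x i) := in_l1M h1 x1.
have nu1 := in_l1_norm u1; have nun1 := in_l1_norm un1.
have t1 := in_l1_norm (in_l1_tail (N := N) h1).
have t21 : in_l1 (fun i => 2^-1 * `|tail N h i|).
  have := @in_l1M _ _ (fun=> 2^-1) 2^-1 t1; rewrite ger0_norm ?invr_ge0 //.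
  move=> /(_ (fun=> lexx _)); congr in_l1; apply/funext => i; exact: mulrC.
rewrite /l1norm -rsumZ // -!rsumD //; last exact: in_l1D.
apply: rsum_le => // [|i]; first by do 2 apply: in_l1D => //.
have -> : ((fun i => `|u i|) + (fun i => h i * x i)
    + (fun i => 2^-1 * `|tail N h i|)) i
    = `|u i| + (un i - u i) * x i + 2^-1 * `|tail N h i| by [].
have le1 : un i * x i <= `|un i| * `|x i|.
  by rewrite -normrM ler_norm.
have le2 : `|un i| * `|x i| <= `|un i| by rewrite ler_piMr.
have uiE : `|u i| = u i * x i.
  have [->|/xs ->] := eqVneq (u i) 0; first by rewrite normr0 mul0r.
  by rewrite normrEsg mulrC.
rewrite /tail; case: ltnP => [iN|Ni]; first by rewrite normr0 uiE; lra.
have ui0 : u i = 0.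
  apply/eqP; apply: contrapT => /negP ui; have := xN _ Ni.
  by rewrite (xs _ ui) normr_sg ui /=; lra.
have -> : h i = un i by rewrite /h -[un i]subr0 -ui0.
have : `|un i| * `|x i| <= `|un i| * 2^-1 by rewrite ler_wpM2l // xN.
by rewrite ui0 normr0; lra.
Qed.

(* Each coordinate below N is h tested against a dual element w j, up to the
   contribution of the tail of h. *)
Lemma l1norm_le_dual (R : realType) (h : nat -> R) (a : nat -> nat -> R) N B E :
  in_l1 h -> (forall j i, (j < N)%N -> `|a j i| <= B) ->
  (forall i j, (i < N)%N -> (j < N)%N -> a j i = (i == j)%:R) ->
  (forall j, (j < N)%N -> `|rsum (fun i => h i * a j i)| <= E) ->
  l1norm h <= N%:R * (E + B * l1norm (tail N h)) + l1norm (tail N h).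
Proof.
move=> h1 aB adual aE; rewrite (@l1norm_split _ N) // lerD2r.
have -> : N%:R * (E + B * l1norm (tail N h))
  = \sum_(j < N) (E + B * l1norm (tail N h)).
  by rewrite sumr_const card_ord mulr_natl.
apply: ler_sum => j _; have aBj i := aB j i (ltn_ord j).
have := rsum_split N (in_l1M h1 aBj).
rewrite (bigD1 j) //= adual // eqxx mulr1 big1 ?addr0; last first.
  by move=> i ij; rewrite adual // val_eqE (negbTE ij) mulr0.
have -> : tail N (fun i => h i * a j i) = (fun i => tail N h i * a j i).
  by apply/funext => i; rewrite /tail; case: ifP; rewrite ?mul0r.
move=> /eqP; rewrite -subr_eq => /eqP <-.
apply: le_trans (ler_normB _ _) _; apply: lerD; first exact: aE.
by apply: norm_rsum_mul => //; exact: in_l1_tail.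
Qed.

Lemma uniform_approximation (R : realType) (H : normedModType R)
  (P : nat -> H -> H) (w : nat -> H) N (e : R) :
  (forall v, P n v @[n --> \oo] --> v) -> 0 < e ->
  exists n0, forall n j, (n0 <= n)%N -> (j < N)%N -> `|w j - P n (w j)| <= e.
Proof.
move=> Pcv e0; elim: N => [|N [n0 IH]]; first by exists 0%N.
have /cvgrPdist_le/(_ e e0)[n1 _ n1P] := Pcv (w N).
exists (maxn n0 n1) => n j; rewrite geq_max => /andP[n0n n1n].
by rewrite ltnS leq_eqVlt => /orP[/eqP ->|jN]; [exact: n1P|exact: IH].
Qed.

(** * Bounds involving [kappa] *)

Section KappaBounds.
Variables (R : realType) (H : normedModType R) (A : H -> nat -> R) (M : R).
Hypothesis linA : forall (a : R) x y, A (a *: x + y) = (fun i => a * A x i + A y i).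
Hypothesis A_c0 : forall z, in_c0 (A z).
Hypothesis AM : forall z i, `|A z i| <= M * `|z|.
Hypothesis A_inj : forall x y, A x = A y -> x = y.

Lemma supnorm_gt0 z : z != 0 -> 0 < supnorm (A z).
Proof.
move=> z0; rewrite ltNge; apply: contra z0 => sup_le0; apply/eqP; apply: A_inj.
apply/funext => i; rewrite (linear_seq_zero linA); apply/eqP.
by rewrite -normr_le0 (le_trans _ sup_le0) // norm_le_supnorm.
Qed.

Lemma norm_le_kappa (S : set H) (k : R) z b : kappa A S = k%:E ->
  (S `\ 0) z -> (forall i, `|A z i| <= b) -> `|z| <= k * b.
Proof.
move=> kE [Sz /= /eqP z0] Ab; have Az0 := supnorm_gt0 z0.
have zk : `|z| <= k * supnorm (A z).
  rewrite -ler_pdivrMr // -lee_fin -kE; apply: ereal_sup_ubound.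
  by exists z => //; split => //; exact/eqP.
apply: le_trans zk _; rewrite ler_wpM2l ?supnorm_le //.
rewrite leNgt; apply/negP => k0.
have : `|z| / supnorm (A z) <= k.
  rewrite -lee_fin -kE; apply: ereal_sup_ubound.
  by exists z => //; split => //; exact/eqP.
apply/negP; rewrite -ltNge (lt_le_trans k0) // divr_ge0 // ltW //.
Qed.

(** Boundedness of [A] makes every quotient in the supremum at least [1 / M]. This lets terms in
    [delta] alone be absorbed into [delta * k]. *)
Lemma kappa_lower_bound (S : set H) (k : R) z : kappa A S = k%:E ->
  (S `\ 0) z -> 1 <= M * k.
Proof.
move=> kE Sz; have := norm_le_kappa kE Sz (AM z).
case: Sz => _ /= /eqP; rewrite -normr_gt0 => z0.
by rewrite mulrCA mulrA ler_pMl.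
Qed.

End KappaBounds.

(** * Pairing and absorption estimates *)

(** Split [v] into [p] and [v - p]: on [p] the pairing is [ip g p], bounded by Cauchy-Schwarz, and
    the remainder is bounded by the sup norm of [A (v - p)] times the l1 norm of [h]. *)
Lemma approximate_pairing_bound (R : realType) (H : normedModType R)
  (ip : H -> H -> R) (A : H -> nat -> R) (M : R) (S : set H) (h : nat -> R)
  (g v p : H) (d e : R) :
  is_inner_product ip ->
  (forall (a : R) x y, A (a *: x + y) = (fun i => a * A x i + A y i)) ->
  (forall z i, `|A z i| <= M * `|z|) -> 0 <= M -> in_l1 h ->
  (forall z, S z -> rsum (fun i => h i * A z i) = ip g z) ->
  `|g| <= d -> S p -> `|v - p| <= e ->
  `|rsum (fun i => h i * A v i)| <= d * (`|v| + e) + M * e * l1norm h.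
Proof.
move=> ipP linA AM M0 h1 hg gd Sp vp.
have -> : (fun i => h i * A v i)
    = (fun i => h i * A p i) + (fun i => h i * A (v - p) i).
  apply/funext => i; rewrite !fctE -mulrDr; congr (_ * _).
  by rewrite -{1}[v](subrK p) -[X in A (X + p)]scale1r linA mul1r addrC.
rewrite rsumD; [|exact: in_l1M h1 (AM p)|exact: in_l1M h1 (AM _)].
have vpM i : `|A (v - p) i| <= M * e by rewrite (le_trans (AM _ _)) // ler_wpM2l.
apply: le_trans (ler_normD _ _) _; apply: lerD; last exact: norm_rsum_mul.
rewrite hg // (le_trans (normr_ip_le ipP _ _)) // ler_pM //.
have -> : p = v - (v - p) by rewrite opprB addrC subrK.
by rewrite (le_trans (ler_normB _ _)) // lerD2l.
Qed.

(** Here [X] is the whole error and [b] its tail. Inserting the bound on [b] into that on [X] leaves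
    [X] on the right with coefficient [(n + 2 * G) * E], at most one half; [d <= M * K] converts the
    rest to multiples of [K]. *)
Lemma absorb_error (R : realFieldType) (X b K d D0 D1 M B E n : R) :
  0 <= X -> 0 <= n -> 0 <= B -> 0 <= D0 -> 0 <= D1 ->
  2^-1 * b <= K + d * D0 + E * X ->
  X <= n * (d * D1 + E * X + B * b) + b ->
  d <= M * K -> (n + 2 * (1 + n * B)) * E <= 2^-1 ->
  X <= 2 * (n * (M * D1) + 2 * (1 + n * B) * (1 + M * D0)) * K.
Proof.
move=> X0 n0 B0 D00 D10 bK Xb dM nE; set G := 1 + n * B in nE *.
have G0 : 0 <= G by rewrite addr_ge0 ?mulr_ge0.
have := ler_wpM2l G0 bK; have := ler_wpM2r X0 nE.
have := ler_wpM2r (mulr_ge0 n0 D10) dM.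
have := ler_wpM2r (mulr_ge0 G0 D00) dM.
have : X <= n * (d * D1 + E * X) + G * b by move: Xb; rewrite /G; lra.
lra.
Qed.

(** * Choice of the constants and the error estimate *)

Theorem theorem4 (R : realType) (H : completeNormedModType R)
  (ip : H -> H -> R) (A : H -> nat -> R) (Astar : (nat -> R) -> H)
  (Hn : nat -> set H) (P : nat -> H -> H)
  (f : H) (udag : nat -> R) (vdag : H) :
  is_inner_product ip ->
  (* A : H -> c0 bounded linear *)
  (forall (a : R) x y, A (a *: x + y) = (fun i => a * A x i + A y i)) ->
  (forall z, in_c0 (A z)) ->
  (exists M : R, forall z i, `|A z i| <= M * `|z|) ->
  (* A^* : l1 -> H is the adjoint: <A^* u, z> = sum_i u_i (A z)_i *)
  (forall u, in_l1 u -> forall z, ip (Astar u) z = rsum (fun i => u i * A z i)) ->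
  (* A and A^* injective *)
  (forall x y, A x = A y -> x = y) ->
  (forall u w, in_l1 u -> in_l1 w -> Astar u = Astar w -> u = w) ->
  (* subspaces H_n of dimension n with orthogonal projections P_n -> id *)
  (forall n, subspace_dim (Hn n) n) ->
  (forall n, is_orth_proj ip (Hn n) (P n)) ->
  (forall v, P n v @[n --> \oo] --> v) ->
  (* source condition *)
  in_l1 udag -> Astar udag = f ->
  (forall i, `|A vdag i| <= 1) ->
  (forall i, udag i != 0 -> A vdag i = Num.sg (udag i)) ->
  (forall i, `|A vdag i| = 1 <-> udag i != 0) ->
  exists C : R, 0 < C /\ exists n0 : nat, forall n, (n0 <= n)%N ->
    forall (delta : R), 0 < delta -> forall fd : H, `|fd - f| <= delta ->
    forall un : nat -> R,
      in_l1 un -> P n (Astar un) = P n fd ->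
      (forall u, in_l1 u -> P n (Astar u) = P n fd -> l1norm un <= l1norm u) ->
      ((l1norm (un - udag))%:E <= (C * delta)%:E * kappa A (Hn n))%E.
Proof.
move=> ipP linA A_c0 [M0 AM0] adj A_inj Astar_inj dimS PP Pcv.
move=> u1 fE Av1 Avs _.
(* The given bound [M0] may fail to be positive, and [M] occurs in a denominator below. *)
pose M := `|M0| + 1.
have Mpos : 0 < M by rewrite ltr_wpDl.
have AM z i : `|A z i| <= M * `|z|.
  rewrite (le_trans (AM0 z i)) // ler_wpM2r // (le_trans (ler_norm _)) //.
  by rewrite lerDl.
have [N AN] : exists N, forall i, (N <= i)%N -> `|A vdag i| <= 2^-1.
  by apply: in_c0_near => //; rewrite invr_gt0.
have [w wP] := dual_system ipP linA adj Astar_inj N.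
pose W := \sum_(j < N) `|w j|.
have W0 : 0 <= W by apply: sumr_ge0.
have wW j : (j < N)%N -> `|w j| <= W.
  by move=> jN; rewrite /W (bigD1 (Ordinal jN)) //= lerDl sumr_ge0.
pose n_ : R := N%:R; pose B := M * W; pose G := 1 + n_ * B.
have n_0 : 0 <= n_ by rewrite ler0n.
have B0 : 0 <= B by rewrite mulr_ge0 // ltW.
have G1 : 1 <= G by rewrite lerDl mulr_ge0.
have nG0 : 0 < n_ + 2 * G by lra.
(* The bound 1 makes [D0] and [D1] independent of [e]; the other one is the smallness required by
   [absorb_error] with [E = M * e]. *)
pose e := Num.min 1 (2^-1 / (M * (n_ + 2 * G))).
have e0 : 0 < e by rewrite lt_min ltr01 divr_gt0 ?invr_gt0 ?mulr_gt0.
have e1 : e <= 1 by rewrite ge_min lexx.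
have eE : (n_ + 2 * G) * (M * e) <= 2^-1.
  have : e <= 2^-1 / (M * (n_ + 2 * G)) by rewrite ge_min lexx orbT.
  rewrite ler_pdivlMr ?mulr_gt0 //.
  by have -> : e * (M * (n_ + 2 * G)) = (n_ + 2 * G) * (M * e) by ring.
have [n1 n1P] := uniform_approximation w N Pcv e0.
have [n2 n2P] := uniform_approximation (fun=> vdag) 1 Pcv e0.
pose D0 := `|vdag| + 1; pose D1 := W + 1.
have D00 : 0 <= D0 by rewrite addr_ge0.
have D10 : 0 <= D1 by rewrite addr_ge0.
pose C := 2 * (n_ * (M * D1) + 2 * G * (1 + M * D0)).
have C0 : 0 < C.
  rewrite mulr_gt0 // ltr_wpDl ?mulr_ge0 ?(ltW Mpos) // mulr_gt0 //; first lra.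
  by rewrite ltr_pwDl // mulr_ge0 // ltW.
(* Index 0 is excluded: the space of dimension 0 has no nonzero vector, and the supremum over the
   empty set is [-oo]. *)
exists C; split => //; exists (maxn 1 (maxn n1 n2)) => n.
rewrite !geq_max => /and3P[n_gt0 n1n n2n] delta d0 fd fdd un un1 unfd un_min.
have [z0 Sz0] : (Hn n `\ 0) !=set0.
  case: n n_gt0 {n1n n2n unfd un_min} => // n _.
  exact: subspace_dim_nonzero (dimS _).
have SD := subspace_dim_lin (dimS n).
(* For [+oo] the claim is immediate because [C * delta] is positive; [-oo] is impossible because
   [z0] contributes a real number. *)
case kE : (kappa A (Hn n)) => [k| |]; last 2 first.
- by rewrite gt0_muley ?leey // lte_fin mulr_gt0.
- have : ((`|z0| / supnorm (A z0))%:E <= kappa A (Hn n))%E.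
    by apply: ereal_sup_ubound; exists z0.
  by rewrite kE leeNy_eq.
rewrite -EFinM lee_fin -mulrA.
have Mk : 1 <= M * k := kappa_lower_bound linA A_c0 AM A_inj kE Sz0.
have k0 : 0 <= k.
  rewrite leNgt; apply/negP => k0.
  have : M * k < 0 by rewrite pmulr_rlt0.
  lra.
pose K := delta * k.
have K0 : 0 <= K by rewrite mulr_ge0 // ltW.
have dMK : delta <= M * K by rewrite mulrCA ler_pMr.
pose g := fd - f.
have [c [c1 cK cg]] : exists c, [/\ in_l1 c, l1norm c <= K &
    forall z, Hn n z -> rsum (fun i => c i * A z i) = ip g z].
  apply: bounded_functional_extension => //.
  - exact: subspace_dim_zero (dimS n).
  - by move=> a x y; rewrite ![ip g _](ipC ipP) (ipDZl ipP).
  - move=> z b Sz Azb; have [->|znz] := eqVneq z 0.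
      rewrite (ipC ipP) (ip0l ipP) mulr_ge0 //.
      by rewrite (le_trans _ (Azb 0%N)).
    rewrite (le_trans (ip_le ipP _ _)) // -mulrA ler_pM //.
    apply: (norm_le_kappa linA A_c0 A_inj kE) => //.
    by split => //; exact/eqP.
have uc1 := in_l1D u1 c1.
have un_le : l1norm un <= l1norm udag + K.
  apply: le_trans (un_min _ uc1 _) _; last first.
    by rewrite (le_trans (l1normD u1 c1)) // lerD2l.
  (* Feasibility of [udag + c]: on [Hn n] it pairs with [A z] as [f + g = fd] pairs with [z]. *)
  apply/(orth_proj_eqP ipP _ _ SD (PP n)) => z Sz.
  rewrite (ipBl ipP) adj //.
  have -> : (fun i => (udag + c) i * A z i)
      = (fun i => udag i * A z i) + (fun i => c i * A z i).
    by apply/funext => i; rewrite !fctE mulrDl.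
  rewrite rsumD; [|exact: in_l1M u1 (AM z)|exact: in_l1M c1 (AM z)].
  by rewrite cg // -adj // fE (ipBl ipP); ring.
set h := un - udag.
have h1 : in_l1 h by apply: in_l1D => //; exact: in_l1N.
have hg z : Hn n z -> rsum (fun i => h i * A z i) = ip g z.
  move=> Sz; have -> : (fun i => h i * A z i)
      = (fun i => un i * A z i) + - (fun i => udag i * A z i).
    by apply/funext => i; rewrite !fctE mulrDl mulNr.
  have uA1 := in_l1M u1 (AM z).
  rewrite rsumD; [|exact: in_l1M un1 (AM z)|exact: in_l1N].
  rewrite rsumN // -!adj // fE.
  have /(orth_proj_eqP ipP _ _ SD (PP n))/(_ z Sz) := unfd.
  by rewrite !(ipBl ipP); lra.
have bound v : `|v - P n v| <= e ->
    `|rsum (fun i => h i * A v i)| <= delta * (`|v| + e) + M * e * l1norm h.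
  have [SPv _] := PP n v.
  exact: approximate_pairing_bound ipP linA AM (ltW Mpos) h1 hg fdd SPv.
have X0 : 0 <= l1norm h.
  rewrite -[l1norm h]mul1r.
  by apply: le_trans (norm_rsum_mul (x := fun=> 1) h1 _) => // i; rewrite normr1.
apply: (@absorb_error _ _ (l1norm (tail N h)) _ delta D0 D1 _ B (M * e)) => //.
(* The norm of [udag] cancels between this lower bound and [un_le], leaving half of the tail. *)
- have := sign_source_lower_bound u1 un1 Av1 Avs AN.
  have : `|rsum (fun i => h i * A vdag i)| <= delta * D0 + M * e * l1norm h.
    rewrite (le_trans (bound _ (n2P n 0%N n2n _))) // lerD2r.
    by rewrite ler_wpM2l ?(ltW d0) // lerD2l.
  by rewrite ler_norml -/h -/K => /andP[]; lra.
- apply: (l1norm_le_dual (a := fun j => A (w j))) => //.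
    move=> j i jN; rewrite (le_trans (AM _ _)) // ler_wpM2l ?(ltW Mpos) //.
    exact: wW.
  move=> j jN; rewrite (le_trans (bound _ (n1P n j n1n jN))) // lerD2r.
  by rewrite ler_wpM2l ?(ltW d0) // lerD // wW.
Qed.
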